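(* Let $\Bbbk$ be a field and let $A$ be an Artinian standard graded nearly Gorenstein $\Bbbk$-algebra. Then the Veronese subalgebra $A^{(d)}$ is nearly Gorenstein for every integer $d\ge1$.
   Context: A standard graded $\Bbbk$-algebra is a (commutative) Noetherian graded algebra $A=\bigoplus_{i\ge0}A_i$ with $A_0=\Bbbk$, generated as a $\Bbbk$-algebra by $A_1$. For $d\ge1$, $A^{(d)}=\bigoplus_{i\ge0}A_{id}$, with $A_{id}$ placed in degree $i$. The graded canonical module of an Artinian standard graded algebra $A$ is $\omega_A$ with $[\omega_A]_j=\operatorname{Hom}_\Bbbk(A_{-j},\Bbbk)$. The trace of a finite graded $A$-module $M$ is $\operatorname{tr}_A(M)=\sum_{\varphi\in\operatorname{Hom}_A(M,A)}\varphi(M)$. A standard graded Cohen--Macaulay algebra $A$ is nearly Gorenstein if its graded maximal ideal is contained in $\operatorname{tr}_A(\omega_A)$. *)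

(* Defs.v *)
From HB Require Import structures.
From mathcomp Require Import all_boot all_order all_algebra.
From mathcomp Require Import boolp functions.

Set Implicit Arguments.
Unset Strict Implicit.
Unset Printing Implicit Defensive.

Import GRing.Theory.
Local Open Scope ring_scope.

Section RingNotions.
Variable R : comNzRingType.

Definition ideal (I : {pred R^o}) : Prop := submod_closed I.

Definition finitely_generated (I : {pred R^o}) : Prop :=
  exists (n : nat) (g : 'I_n -> R), (forall i, g i \in I) /\
    forall x, x \in I -> exists c : 'I_n -> R, x = \sum_i c i * g i.

Definition noetherian : Prop :=
  forall I : {pred R^o}, ideal I -> finitely_generated I.

Definition artinian : Prop :=
  forall I : nat -> {pred R^o}, (forall n, ideal (I n)) ->
    (forall n, {subset I n.+1 <= I n}) ->
    exists N : nat, forall n, (N <= n)%N -> I n =i I N.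

(* [submod_trace M x] : x lies in the sum of the ideals phi(M), where phi runs
   over Hom_R(M, R). *)
Definition submod_trace (M : lmodType R) (x : R) : Prop :=
  exists (n : nat) (phi : 'I_n -> {linear M -> R^o}) (m : 'I_n -> M),
    x = \sum_i phi i (m i).

End RingNotions.

(* Commutative N-graded algebras: the underlying k-algebra is the internal
   direct sum of the subspaces [hpart i]. *)
Record gradedAlgebra (k : fieldType) := GradedAlgebra {
  galg :> comAlgType k;
  hpart : nat -> {pred galg};
  hpart_submod : forall i, submod_closed (hpart i);
  hpart1 : 1 \in hpart 0;
  hpartM : forall i j x y,
    x \in hpart i -> y \in hpart j -> x * y \in hpart (i + j);
  hpart_span : forall x, exists (n : nat) (f : nat -> galg),
    (forall i, f i \in hpart i) /\ x = \sum_(i < n) f i;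
  hpart_indep : forall (n : nat) (f : nat -> galg),
    (forall i, f i \in hpart i) -> \sum_(i < n) f i = 0 ->
    forall i, (i < n)%N -> f i = 0
}.
Arguments hpart {k} A i : rename.
Arguments hpart_submod {k} A i : rename.
Arguments hpart1 {k} A : rename.
Arguments hpartM {k A i j x y} _ _ : rename.
Arguments hpart_span {k} A x : rename.
Arguments hpart_indep {k A n f} _ _ i _ : rename.

Section GradedNotions.
Variables (k : fieldType) (A : gradedAlgebra k).

(* The graded maximal ideal, when A_0 = k. *)
Definition irrelevant_ideal (x : A) : Prop :=
  exists (n : nat) (f : nat -> A),
    (forall i, f i \in hpart A i.+1) /\ x = \sum_(i < n) f i.

Definition standard_graded : Prop :=
  [/\ noetherian A,
      forall x : A, x \in hpart A 0 <-> exists c : k, x = c%:A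
    & forall S : {pred A}, subalg_closed S -> {subset hpart A 1 <= S} ->
        forall x : A, x \in S].

(* omega_A = (+)_j Hom_k(A_{-j}, k), realised inside the linear forms on A: a
   family in the product of the Hom_k(A_i, k) is a linear form on A, and it lies
   in the direct sum iff the form vanishes on A_i for all i >> 0. *)
Definition canonical_pred : {pred A -> k^o} := fun f =>
  `[< linear f /\
      exists n : nat, forall i x, (n <= i)%N -> x \in hpart A i -> f x = 0 >].

Fact canonical_zmod_closed : zmod_closed canonical_pred.
Proof.
split.
  apply/asboolP; split; last by exists 0%N.
  by move=> a x y; rewrite /= scaler0 addr0.
move=> f g /asboolP[fL [n fn]] /asboolP[gL [m gm]]; apply/asboolP; split.
  move=> a x y; rewrite !(addrfctE, opprfctE) fL gL scalerBr opprD.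
  by rewrite addrACA.
exists (maxn n m) => i x; rewrite geq_max => /andP[ni mi] Ax.
by rewrite !(addrfctE, opprfctE) (fn i) // (gm i) // subr0.
Qed.

HB.instance Definition _ :=
  GRing.isZmodClosed.Build (A -> k^o) canonical_pred canonical_zmod_closed.

Record canonical_module := CanonicalModule {
  canonical_form :> A -> k^o;
  canonical_formP : canonical_form \in canonical_pred
}.

HB.instance Definition _ := [isSub for canonical_form].
HB.instance Definition _ := [Choice of canonical_module by <:].
HB.instance Definition _ := [SubChoice_isSubZmodule of canonical_module by <:].

Fact canonical_scale_subproof (a : A) (f : canonical_module) :
  (fun x => f (a * x)) \in canonical_pred.
Proof.
have /asboolP[fL [n fn]] := canonical_formP f.
have f0 : f 0 = 0 by have := fL (-1) 0 0; rewrite scaler0 addr0 scaleN1r addNr.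
apply/asboolP; split; first by move=> c x y; rewrite mulrDr -scalerAr fL.
exists n => i x ni Ax; have [m [g [Ag ->]]] := hpart_span A a.
rewrite mulr_suml; elim/big_ind: _ => // [u v fu fv|j _].
  by have := fL 1 u v; rewrite !scale1r fu fv addr0.
by apply: (fn (j + i)%N); [exact: leq_trans ni (leq_addl _ _) | exact: hpartM].
Qed.

Definition canonical_scale (a : A) (f : canonical_module) : canonical_module :=
  CanonicalModule (canonical_scale_subproof a f).

Fact canonical_scaleA a b f :
  canonical_scale a (canonical_scale b f) = canonical_scale (a * b) f.
Proof. by apply/val_inj/funext => x /=; rewrite mulrA (mulrC b). Qed.

Fact canonical_scale1 : left_id 1 canonical_scale.
Proof. by move=> f; apply/val_inj/funext => x /=; rewrite mul1r. Qed.

Fact canonical_scaleDr : right_distributive canonical_scale +%R.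
Proof. by move=> a f g; apply/val_inj/funext. Qed.

Fact canonical_scaleDl f : {morph canonical_scale^~ f : a b / a + b}.
Proof.
move=> a b; apply/val_inj/funext => x /=.
have /asboolP[fL _] := canonical_formP f.
by have := fL 1 (a * x) (b * x); rewrite !scale1r -mulrDl.
Qed.

HB.instance Definition _ := GRing.Zmodule_isLmodule.Build A canonical_module
  canonical_scaleA canonical_scale1 canonical_scaleDr canonical_scaleDl.

(* In the Artinian case only, where Cohen-Macaulayness is automatic and
   [canonical_module] is the graded canonical module. *)
Definition nearly_gorenstein : Prop :=
  [/\ standard_graded, artinian A
    & forall x : A, irrelevant_ideal x -> submod_trace canonical_module x].

End GradedNotions.

Section Veronese.
Variables (k : fieldType) (A : gradedAlgebra k) (d : nat).

Definition veronese_pred : {pred A} := fun x =>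
  `[< exists (n : nat) (f : nat -> A),
        (forall i, f i \in hpart A (i * d)) /\ x = \sum_(i < n) f i >].

Fact hpart0 i : 0 \in hpart A i. Proof. by case: (hpart_submod A i). Qed.

Fact hpart_lin i a x y :
  x \in hpart A i -> y \in hpart A i -> a *: x + y \in hpart A i.
Proof. by case: (hpart_submod A i) => _ h *; apply: h. Qed.

Fact hpart_veronese i x : x \in hpart A (i * d) -> x \in veronese_pred.
Proof.
move=> Ax; apply/asboolP; exists i.+1, (fun j => if j == i then x else 0).
split=> [j|]; first by case: eqP => [->//|_]; exact: hpart0.
by rewrite big_ord_recr /= eqxx big1 ?add0r // => j _; rewrite ltn_eqF.
Qed.

Fact veronese_lin a x y :
  x \in veronese_pred -> y \in veronese_pred -> a *: x + y \in veronese_pred.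
Proof.
move=> /asboolP[n [f [Af ->]]] /asboolP[m [g [Ag ->]]]; apply/asboolP.
have pad (h : nat -> A) p q : (p <= q)%N ->
    \sum_(i < p) h i = \sum_(i < q) (if (i < p)%N then h i else 0).
  by move=> pq; rewrite (big_ord_widen q) // big_mkcond.
exists (maxn n m), (fun i => a *: (if (i < n)%N then f i else 0)
                             + (if (i < m)%N then g i else 0)).
split=> [i|].
  by apply: hpart_lin; case: ifP => // _; exact: hpart0.
by rewrite big_split /= -scaler_sumr -!pad ?leq_maxl ?leq_maxr.
Qed.

Fact veronese_subalg_closed : subalg_closed veronese_pred.
Proof.
have V0 : 0 \in veronese_pred by apply: (@hpart_veronese 0); exact: hpart0.
have VD x y : x \in veronese_pred -> y \in veronese_pred ->
    x + y \in veronese_pred.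
  by move=> Vx Vy; rewrite -[x]scale1r; exact: veronese_lin.
split; first by apply: (@hpart_veronese 0); exact: hpart1.
  by move=> a x y; exact: veronese_lin.
move=> _ _ /asboolP[n [f [Af ->]]] /asboolP[m [g [Ag ->]]].
rewrite mulr_suml; elim/big_ind: _ => // i _.
rewrite mulr_sumr; elim/big_ind: _ => // j _.
by apply: (@hpart_veronese (i + j)); rewrite mulnDl; exact: hpartM.
Qed.

HB.instance Definition _ :=
  GRing.isSubalgClosed.Build k A veronese_pred
    (GRing.subalg_closed_semi veronese_subalg_closed).

Record veronese_sub := VeroneseSub {
  veronese_val :> A;
  veronese_valP : veronese_val \in veronese_pred
}.

HB.instance Definition _ := [isSub for veronese_val].
HB.instance Definition _ := [Choice of veronese_sub by <:].
HB.instance Definition _ := [SubChoice_isSubComNzRing of veronese_sub by <:].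
HB.instance Definition _ := [SubZmodule_isSubLmodule of veronese_sub by <:].
HB.instance Definition _ :=
  [SubNzRing_SubLmodule_isSubLalgebra of veronese_sub by <:].
HB.instance Definition _ := [SubLalgebra_isSubAlgebra of veronese_sub by <:].

Definition veronese_hpart (i : nat) : {pred veronese_sub} :=
  fun x => val x \in hpart A (i * d).

Fact veronese_hpartE i (x : veronese_sub) :
  (x \in veronese_hpart i) = (val x \in hpart A (i * d)).
Proof. by []. Qed.

Fact veronese_hpart_submod i : submod_closed (veronese_hpart i).
Proof.
split; first by rewrite veronese_hpartE raddf0; exact: hpart0.
move=> a x y Ax Ay; rewrite veronese_hpartE GRing.valD GRing.valZ.
exact: hpart_lin.
Qed.

Fact veronese_hpart1 : 1 \in veronese_hpart 0.
Proof. by rewrite veronese_hpartE rmorph1 hpart1. Qed.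

Fact veronese_hpartM i j (x y : veronese_sub) :
  x \in veronese_hpart i -> y \in veronese_hpart j ->
  x * y \in veronese_hpart (i + j).
Proof.
move=> Ax Ay; rewrite veronese_hpartE rmorphM mulnDl.
exact: hpartM.
Qed.

Fact veronese_hpart_span (x : veronese_sub) :
  exists (n : nat) (f : nat -> veronese_sub),
    (forall i, f i \in veronese_hpart i) /\ x = \sum_(i < n) f i.
Proof.
have /asboolP[n [f [Af xE]]] := veronese_valP x.
exists n, (fun i => VeroneseSub (hpart_veronese (Af i))); split=> //.
by apply: val_inj; rewrite raddf_sum -xE.
Qed.

Hypothesis d_gt0 : (0 < d)%N.

Fact veronese_hpart_indep (n : nat) (f : nat -> veronese_sub) :
  (forall i, f i \in veronese_hpart i) -> \sum_(i < n) f i = 0 ->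
  forall i, (i < n)%N -> f i = 0.
Proof.
move=> Af f0 i ltin.
pose g j := if (d %| j)%N then val (f (j %/ d)%N) else 0.
have Ag j : g j \in hpart A j.
  rewrite /g; case: ifP => [dj|_]; last exact: hpart0.
  by have := Af (j %/ d)%N; rewrite veronese_hpartE divnK.
have gE j : g (j * d)%N = val (f j) by rewrite /g dvdn_mull // mulnK.
have g0 : \sum_(j < n * d) g j = 0.
  have -> : \sum_(j < n * d) g j = \sum_(j < n) val (f j).
    elim: n {f0 ltin} => [|m IH]; first by rewrite !big_ord0.
    rewrite mulSn addnC big_split_ord big_ord_recr /= IH; congr (_ + _).
    rewrite -(prednK d_gt0) big_ord_recl /= addn0 (prednK d_gt0) gE.
    rewrite big1 ?addr0 // => j _; rewrite /g dvdn_addr ?dvdn_mull //.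
    rewrite gtnNdvd //=.
    by have := ltn_ord j; rewrite -ltnS (prednK d_gt0).
  by rewrite -raddf_sum f0 raddf0.
apply: val_inj; rewrite raddf0 -gE.
by apply: (hpart_indep Ag g0); rewrite ltn_pmul2r.
Qed.

Definition veronese : gradedAlgebra k :=
  @GradedAlgebra k veronese_sub veronese_hpart veronese_hpart_submod
    veronese_hpart1 veronese_hpartM veronese_hpart_span veronese_hpart_indep.

End Veronese.

(* Main.v *)
From HB Require Import structures.
Require Import Defs.
From mathcomp Require Import all_boot all_order all_algebra.
From mathcomp Require Import boolp functions.

(** Write V for the Veronese subalgebra A^(d), m for the graded maximal ideal
of A, omega for canonical modules, and rho : A -> V for the projection that
kills the homogeneous parts of degree not divisible by d.  The map rho is
V-linear and restricts to the identity of V.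

The chain conditions descend along such a retraction, because I A meets V in I
for every ideal I of V ([noetherian_retract], [artinian_retract]).  As A is
generated in degree 1, A_(m+n) = A_m A_n ([hpartD_ind]); hence V is generated
by V_1 = A_d ([standard_veronese]).

For the trace, V_(i+1) = V_1 V_i reduces the claim to V_1 = A_d = A_1 A_(d-1),
so to l w with l in A_1 and w in A_(d-1).  Since l lies in m, near
Gorensteinness writes l as a sum of values phi(f) with phi : omega_A -> A
linear.  Split f into its parts f_r (r < d), where f_r sees only the degrees
congruent to r modulo d.  It remains to treat rho(w phi(f_r)), and w may be
taken to be b c with b in A_r and c in A_(d-1-r).  The factor b moves inside phi
and shifts f_r to a form that sees only degrees divisible by d: b f_r = g o rho,
where g in omega_V is the restriction of b f.  So
rho(b c phi(f_r)) = rho(c phi(g o rho)), which is the value at g of the V-linear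
map h |-> rho(c phi(h o rho)) from omega_V to V ([trace_residue]).  This is why
it matters that w has d - 1 linear factors: every residue r can be reached.
As l w is fixed by rho, these elements rho(w phi(f_r)) add up to l w for
arbitrary phi and f, homogeneous or not. *)

Set Implicit Arguments.
Unset Strict Implicit.
Unset Printing Implicit Defensive.

Import GRing.Theory.
Local Open Scope ring_scope.

(** * Families indexed by a sum of ordinals *)

Section GlueOrd.
Variables (T : Type) (n m : nat) (u : 'I_n -> T) (v : 'I_m -> T).

Definition glue_ord (i : 'I_(n + m)) : T :=
  match fintype.split i with inl j => u j | inr j => v j end.

Lemma glue_ordl i : glue_ord (lshift m i) = u i.
Proof. by rewrite /glue_ord -[lshift m i]/(unsplit (inl i)) unsplitK. Qed.

Lemma glue_ordr i : glue_ord (rshift n i) = v i.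
Proof. by rewrite /glue_ord -[rshift n i]/(unsplit (inr i)) unsplitK. Qed.

End GlueOrd.

(** * Descent of the chain conditions along a retraction *)

Section Retract.
Variables (R S : comNzRingType) (iota : {rmorphism R -> S}) (rho : S -> R).
Hypothesis rhoD : {morph rho : x y / x + y}.
Hypothesis rhoM : forall a s, rho (iota a * s) = a * rho s.
Hypothesis rhoK : cancel iota rho.

Let rho0 : rho 0 = 0. Proof. by rewrite -(rmorph0 iota) rhoK. Qed.

Let rho_sum n (F : 'I_n -> S) : rho (\sum_i F i) = \sum_i rho (F i).
Proof. exact: (big_morph rho rhoD rho0). Qed.

Definition extended_ideal (I : {pred R^o}) : {pred S^o} := fun s =>
  `[< exists (n : nat) (a : 'I_n -> S) (g : 'I_n -> R),
        (forall i, g i \in I) /\ s = \sum_i a i * iota (g i) >].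

Lemma ideal_sum (I : {pred R^o}) n (a g : 'I_n -> R) :
  ideal I -> (forall i, g i \in I) -> \sum_i a i * g i \in I.
Proof.
case=> I0 IL Ig; elim/big_rec: _ => // i x _ Ix.
exact: (IL (a i) (g i) x).
Qed.

Lemma extended_ideal_ideal I : ideal (extended_ideal I).
Proof.
split=> [|c s t /asboolP[n [a [g [Ig ->]]]] /asboolP[m [b [h [Ih ->]]]]].
  apply/asboolP; exists 0%N, (fun=> 0), (fun=> 0).
  by rewrite big_ord0; split=> [[]|].
apply/asboolP.
exists (n + m)%N, (glue_ord (fun i => c * a i) b), (glue_ord g h).
split=> [i|]; first by rewrite /glue_ord; case: fintype.split.
rewrite big_split_ord /= scaler_sumr; congr (_ + _); apply: eq_bigr => i _.
  by rewrite !glue_ordl -[LHS]/(c * (a i * _)) mulrA.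
by rewrite !glue_ordr.
Qed.

Lemma extended_ideal_in (I : {pred R^o}) x :
  x \in I -> iota x \in extended_ideal I.
Proof.
move=> Ix; apply/asboolP; exists 1%N, (fun=> 1), (fun=> x).
by split=> //; rewrite big_ord1 mul1r.
Qed.

(** Applying rho to a combination of elements of I with coefficients in S turns
the coefficients into elements of R. *)
Lemma extended_idealK (I : {pred R^o}) x :
  ideal I -> iota x \in extended_ideal I -> x \in I.
Proof.
move=> II /asboolP[n [a [g [Ig xE]]]]; rewrite -[x]rhoK xE rho_sum.
under eq_bigr do rewrite mulrC rhoM mulrC.
exact: ideal_sum.
Qed.

Lemma artinian_retract : artinian S -> artinian R.
Proof.
move=> artS I idI decI.
have [|n s /asboolP[m [a [g [Ig ->]]]]|N stab] :=
  artS (fun n => extended_ideal (I n)).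
- by move=> n; exact: extended_ideal_ideal.
- by apply/asboolP; exists m, a, g; split=> // i; exact: decI.
exists N => n leNn x; apply/idP/idP => Ix; apply: extended_idealK => //.
  by rewrite -(stab n) //; exact: extended_ideal_in.
by rewrite stab //; exact: extended_ideal_in.
Qed.

(** Finitely many generators of the extension of I are combinations of finitely
many elements of I; applying rho shows that the latter generate I. *)
Lemma noetherian_retract : noetherian S -> noetherian R.
Proof.
move=> noethS I idI.
have [n [h [Ih hgen]]] := noethS _ (extended_ideal_ideal I).
(* Padding with zeros makes the families depend on j only through their
   length, so that they can be chosen uniformly. *)
have /choice[m /choice[a /choice[g hE]]] :
    forall j, exists m, exists a : nat -> S, exists g : nat -> R,
      (forall i, g i \in I) /\ h j = \sum_(i < m) a i * iota (g i).
  move=> j; have /asboolP[m [a [g [Ig hjE]]]] := Ih j.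
  pose ext T (x0 : T) (u : 'I_m -> T) i := oapp u x0 (insub i).
  exists m, (ext S 0 a), (ext R 0 g); split=> [i|].
    by rewrite /ext; case: insub => //=; case: idI.
  by rewrite hjE; apply: eq_bigr => i _; rewrite /ext valK.
pose T := {j : 'I_n & 'I_(m j)}.
pose G (p : T) : R := g (tag p) (tagged p).
exists #|{: T}|, (fun p => G (enum_val p)); split.
  by move=> p; have [Ig _] := hE (tag (enum_val p)); exact: Ig.
move=> x Ix; have [c xE] := hgen _ (extended_ideal_in Ix).
pose C (p : T) : R := rho (c (tag p) * a (tag p) (tagged p)).
exists (fun p => C (enum_val p)).
rewrite -(big_enum_val (fun p => C p * G p)).
rewrite -[x in LHS]rhoK xE rho_sum.
transitivity (\sum_(j < n) \sum_(i < m j) rho (c j * a j i) * g j i).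
  apply: eq_bigr => j _; case: (hE j) => _ ->; rewrite mulr_sumr rho_sum.
  by apply: eq_bigr => i _; rewrite mulrA mulrC rhoM mulrC.
by rewrite (sig_big_dep predT (fun=> predT)
  (fun j (i : 'I_(m j)) => rho (c j * a j i) * g j i)).
Qed.

End Retract.

(** * The trace is an ideal *)

Section Trace.
Variables (R : comNzRingType) (M : lmodType R).

Lemma submod_trace_hom (phi : {linear M -> R^o}) m : submod_trace M (phi m).
Proof. by exists 1%N, (fun=> phi), (fun=> m); rewrite big_ord1. Qed.

Lemma submod_trace0 : submod_trace M 0.
Proof. by exists 0%N, (fun=> \0), (fun=> 0); rewrite big_ord0. Qed.

Lemma submod_traceD x y :
  submod_trace M x -> submod_trace M y -> submod_trace M (x + y).
Proof.
move=> [n [phi [u ->]]] [m [psi [v ->]]].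
exists (n + m)%N, (glue_ord phi psi), (glue_ord u v).
rewrite big_split_ord /=; congr (_ + _); apply: eq_bigr => i _.
  by rewrite !glue_ordl.
by rewrite !glue_ordr.
Qed.

Lemma submod_traceM a x : submod_trace M x -> submod_trace M (a * x).
Proof.
move=> [n [phi [u ->]]]; exists n, phi, (fun i => a *: u i).
by rewrite mulr_sumr; apply: eq_bigr => i _; rewrite linearZ.
Qed.

End Trace.

(** * Projections onto sets of degrees *)

Section Projections.
Variables (k : fieldType) (A : gradedAlgebra k).
Implicit Types (x y : A) (P Q : pred nat).

Lemma hpart_ind (C : A -> Prop) :
  C 0 -> (forall x y, C x -> C y -> C (x + y)) ->
  (forall i x, x \in hpart A i -> C x) -> forall x, C x.
Proof.
move=> C0 CD Ch x; have [n [f [Af ->]]] := hpart_span A x.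
by elim/big_ind: _ => // i _; exact: Ch (Af i).
Qed.

(** The projection as a relation: the decomposition of x into homogeneous parts
is existential, so that linearity can be proved by adding decompositions. *)
Definition hproj_spec P x y :=
  exists (n : nat) (f : nat -> A), [/\ forall i, f i \in hpart A i,
    x = \sum_(i < n) f i & y = \sum_(i < n | P i) f i].

Lemma hproj_ex P x : exists y, hproj_spec P x y.
Proof.
have [n [f [Af xE]]] := hpart_span A x.
by exists (\sum_(i < n | P i) f i), n, f.
Qed.

Lemma hproj_spec_lin P a x y x' y' :
  hproj_spec P x x' -> hproj_spec P y y' ->
  hproj_spec P (a *: x + y) (a *: x' + y').
Proof.
move=> [n [f [Af -> ->]]] [m [g [Ag -> ->]]].
have pad (h : nat -> A) (B : pred nat) p q : (p <= q)%N ->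
    \sum_(i < p | B i) h i = \sum_(i < q | B i) (if (i < p)%N then h i else 0).
  by move=> pq; rewrite (big_ord_widen_cond q) // big_mkcondr.
exists (maxn n m), (fun i => a *: (if (i < n)%N then f i else 0)
                             + (if (i < m)%N then g i else 0)).
split=> [i||].
- by apply: hpart_lin; case: ifP => // _; exact: hpart0.
- by rewrite big_split /= -scaler_sumr -!(pad _ predT) ?leq_maxl ?leq_maxr.
- by rewrite big_split /= -scaler_sumr -!pad ?leq_maxl ?leq_maxr.
Qed.

(** With linearity, the independence of the graded pieces is only needed at 0 to
make the projection well defined. *)
Lemma hproj_spec0 P y : hproj_spec P 0 y -> y = 0.
Proof.
move=> [n [f [Af /esym f0 ->]]]; rewrite big1 // => i _.
exact: (hpart_indep Af f0).
Qed.

Definition hproj P x := projT1 (cid (hproj_ex P x)).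

Lemma hprojE P x y : hproj_spec P x y -> hproj P x = y.
Proof.
move=> xy; apply/eqP; rewrite -subr_eq0; apply/eqP.
have xz := projT2 (cid (hproj_ex P x)); rewrite -/(hproj P x) in xz.
have := hproj_spec_lin (-1) xy xz; rewrite !scaleN1r addNr => /hproj_spec0.
by rewrite addrC.
Qed.

Fact hproj_linear P : linear (hproj P).
Proof.
by move=> a x y; apply: hprojE; apply: hproj_spec_lin; exact: projT2 (cid _).
Qed.

HB.instance Definition _ P :=
  GRing.isLinear.Build k A A *:%R (hproj P) (hproj_linear P).

Lemma hproj_hpart P i x : x \in hpart A i -> hproj P x = if P i then x else 0.
Proof.
move=> Ax; apply: hprojE; exists i.+1, (fun j => if j == i then x else 0).
have sumE (B : pred nat) :
    \sum_(j < i.+1 | B j) (if j == i :> nat then x else 0) =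
    if B i then x else 0.
  rewrite big_mkcond big_ord_recr /= eqxx big1 ?add0r // => j _.
  by rewrite ltn_eqF ?if_same.
split; [|by rewrite (sumE predT)|by rewrite sumE].
by move=> j; case: eqP => [->//|_]; exact: hpart0.
Qed.

(** Multiplication by a homogeneous element shifts degrees, so it exchanges the
projections onto a set of degrees and onto its translate. *)
Lemma hprojM P Q i b x : b \in hpart A i -> (forall j, P (i + j)%N = Q j) ->
  hproj P (b * x) = b * hproj Q x.
Proof.
move=> Ab PQ; elim/hpart_ind: x => [|x y IHx IHy|j x Ax].
- by rewrite !(mulr0, linear0).
- by rewrite mulrDr !linearD /= IHx IHy mulrDr.
- rewrite (hproj_hpart _ (hpartM Ab Ax)) (hproj_hpart _ Ax) PQ.
  by case: ifP; rewrite ?mulr0.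
Qed.

Lemma hproj1_in n x : hproj (pred1 n) x \in hpart A n.
Proof.
elim/hpart_ind: x => [|x y Ax Ay|i x Ax].
- by rewrite linear0 hpart0.
- by rewrite linearD /= -[hproj _ x]scale1r; exact: hpart_lin.
- rewrite (hproj_hpart _ Ax) /=; case: eqP => [<-//|_]; exact: hpart0.
Qed.

Lemma hproj_residues d x : (0 < d)%N ->
  x = \sum_(r < d) hproj (fun i => (i %% d)%N == r) x.
Proof.
move=> d0; elim/hpart_ind: x => [|x y xE yE|i x Ax].
- by rewrite big1 // => r _; rewrite linear0.
- rewrite {1}xE {1}yE -big_split; apply: eq_bigr => r _ /=.
  by rewrite linearD.
- rewrite (bigD1 (Ordinal (ltn_pmod i d0))) //= (hproj_hpart _ Ax) eqxx.
  rewrite big1 ?addr0 // => r rNi; rewrite (hproj_hpart _ Ax).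
  by case: eqP => // ir; case/eqP: rNi; apply/val_inj.
Qed.

Hypothesis stdA : standard_graded A.

(** A_(n+1) = A_1 A_n, as an induction principle: to prove an additive property
on A_(n+1) it suffices to prove it on products.  The elements u such that C
holds of the degree n+1 part of every multiple of u form an ideal, which
contains A_1; adding the scalars to it gives a subalgebra, hence all of A. *)
Lemma hpartS_ind (C : A -> Prop) n :
  C 0 -> (forall x y, C x -> C y -> C (x + y)) ->
  (forall l y, l \in hpart A 1 -> y \in hpart A n -> C (l * y)) ->
  forall x, x \in hpart A n.+1 -> C x.
Proof.
move=> C0 CD CM x Ax; have [_ A0 Agen] := stdA.
pose J u := forall a, C (hproj (pred1 n.+1) (a * u)).
have J0 : J 0 by move=> a; rewrite mulr0 linear0.
have JD u v : J u -> J v -> J (u + v).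
  by move=> Ju Jv a; rewrite mulrDr linearD; apply: CD; [exact: Ju|exact: Jv].
have JM b u : J u -> J (b * u) by move=> Ju a; rewrite mulrA; exact: Ju.
pose S : {pred A} := fun u => `[< exists c : k, J (u - c%:A) >].
have /asboolP[c /(_ 1)] : x \in S.
  apply: (Agen S) => [|l Al].
    split=> [|a u v|u v].
      by apply/asboolP; exists 1; rewrite scale1r subrr.
      move=> /asboolP[c Jc] /asboolP[e Je]; apply/asboolP; exists (a * c + e).
      rewrite scalerDl -scalerA opprD addrACA -scalerBr.
      rewrite -[a *: (_ - _)]mulr_algl.
      by apply: JD => //; exact: JM.
    move=> /asboolP[c Jc] /asboolP[e Je]; apply/asboolP; exists (c * e).
    have -> : u * v - (c * e)%:A = v * (u - c%:A) + c%:A * (v - e%:A).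
      rewrite !mulrBr mulr_algl -[c%:A * e%:A]scalerAl mul1r scalerA.
      by rewrite [v * u]mulrC [v * c%:A]mulrC mulr_algl addrA subrK.
    by apply: JD; exact: JM.
  apply/asboolP; exists 0; rewrite scale0r subr0 => a.
  rewrite mulrC (@hprojM _ (pred1 n) _ _ _ Al) //.
  by apply: CM => //; exact: hproj1_in.
rewrite mul1r linearB /= (hproj_hpart _ Ax) /= eqxx.
have Ac : c%:A \in hpart A 0 by apply/A0; exists c.
by rewrite (hproj_hpart _ Ac) /= subr0.
Qed.

(** Likewise A_(m+n) = A_m A_n. *)
Lemma hpartD_ind (C : A -> Prop) m n :
  C 0 -> (forall x y, C x -> C y -> C (x + y)) ->
  (forall y z, y \in hpart A m -> z \in hpart A n -> C (y * z)) ->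
  forall x, x \in hpart A (m + n) -> C x.
Proof.
elim: m C => [|m IH] C C0 CD CM x.
  by move=> Ax; rewrite -[x]mul1r; apply: CM => //; exact: hpart1.
rewrite addSn; apply: hpartS_ind => // l y Al Ay.
apply: (IH (fun y => C (l * y))) Ay => [|u v Cu Cv|u v Au Av].
- by rewrite mulr0.
- by rewrite mulrDr; exact: CD.
- by rewrite mulrA; apply: CM => //; exact: (hpartM Al Au).
Qed.

End Projections.

(** * The Veronese subalgebra as a retract *)

Section VeroneseRetract.
Variables (k : fieldType) (A : gradedAlgebra k) (d : nat) (d_gt0 : (0 < d)%N).
Local Notation V := (veronese A d_gt0).

Lemma veronese_proj_subproof (x : A) :
  hproj (fun i => (i %% d)%N == 0%N) x \in veronese_pred d.
Proof.
elim/hpart_ind: x => [|x y Ax Ay|i x Ax].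
- by rewrite linear0 rpred0.
- by rewrite linearD rpredD.
- rewrite (hproj_hpart _ Ax); case: ifP => [di|_]; last exact: rpred0.
  by apply: (@hpart_veronese _ _ _ (i %/ d)); rewrite divnK.
Qed.

Definition veronese_proj (x : A) : V := VeroneseSub (veronese_proj_subproof x).

Fact veronese_proj_linear : linear veronese_proj.
Proof.
by move=> a x y; apply/val_inj; rewrite GRing.valD GRing.valZ; exact: linearP.
Qed.

HB.instance Definition _ :=
  GRing.isLinear.Build k A V *:%R veronese_proj veronese_proj_linear.

Definition veronese_incl : V -> A := val.
HB.instance Definition _ := GRing.RMorphism.on veronese_incl.

Lemma veronese_projK : cancel veronese_incl veronese_proj.
Proof.
move=> x; apply/val_inj => /=.
have /asboolP[n [f [Af xE]]] : veronese_incl x \in veronese_pred d.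
  exact: veronese_valP.
rewrite -/(veronese_incl x) xE linear_sum; apply: eq_bigr => i _ /=.
by rewrite (hproj_hpart _ (Af i)) modnMl.
Qed.

Lemma veronese_projM (a : V) (x : A) :
  veronese_proj (veronese_incl a * x) = a * veronese_proj x.
Proof.
apply/val_inj; pose P i := (i %% d)%N == 0%N.
rewrite -[LHS]/(hproj P (veronese_incl a * x)).
rewrite -[RHS]/(veronese_incl a * hproj P x).
have /asboolP[n [f [Af ->]]] : veronese_incl a \in veronese_pred d.
  exact: veronese_valP.
rewrite !mulr_suml linear_sum; apply: eq_bigr => i _ /=.
by apply: hprojM (Af i) _ => j; rewrite /P modnMDl.
Qed.

End VeroneseRetract.

(** * Canonical modules of an algebra and of its Veronese subalgebra *)

Section CanonicalModule.
Variables (k : fieldType) (A : gradedAlgebra k).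
Implicit Types f : canonical_module A.

Lemma canonical_linear f : linear f.
Proof. by have /asboolP[] := canonical_formP f. Qed.

HB.instance Definition _ f :=
  GRing.isLinear.Build k A k^o *:%R f (canonical_linear f).

Lemma canonical_bounded f :
  exists n, forall i x, (n <= i)%N -> x \in hpart A i -> f x = 0.
Proof. by have /asboolP[] := canonical_formP f. Qed.

Fact canonical_hproj_subproof P f : (f \o hproj P) \in @canonical_pred k A.
Proof.
apply/asboolP; split; first by move=> a x y /=; rewrite !linearP.
have [n fn] := canonical_bounded f; exists n => i x ni Ax /=.
by rewrite (hproj_hpart _ Ax); case: ifP => _; rewrite ?linear0 ?(fn i).
Qed.

Definition canonical_hproj P f : canonical_module A :=
  CanonicalModule (canonical_hproj_subproof P f).

(** The splitting is by residues rather than by degrees, so that the number of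
summands is d and each of them can be corrected by a factor of degree < d. *)
Lemma canonical_residues d f : (0 < d)%N ->
  f = \sum_(r < d) canonical_hproj (fun i => (i %% d)%N == r) f.
Proof.
move=> d0; apply/val_inj/funext => x.
rewrite raddf_sum fct_sumE /= {1}(hproj_residues x d0).
by rewrite linear_sum.
Qed.

Variables (d : nat) (d_gt0 : (0 < d)%N).
Local Notation V := (veronese A d_gt0).

Fact canonical_res_subproof f :
  (f \o @veronese_incl k A d d_gt0) \in @canonical_pred k V.
Proof.
apply/asboolP; split.
  move=> a x y.
  by rewrite -[LHS]/(f (a *: veronese_incl x + veronese_incl y)) linearP.
have [n fn] := canonical_bounded f; exists n => i x ni Ax /=.
by apply: (fn (i * d)%N) Ax; rewrite (leq_trans ni) ?leq_pmulr.
Qed.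

Definition canonical_res f : canonical_module V :=
  CanonicalModule (canonical_res_subproof f).

Fact canonical_ext_subproof (g : canonical_module V) :
  (g \o veronese_proj d_gt0) \in @canonical_pred k A.
Proof.
have /asboolP[gL [n gn]] := canonical_formP g.
have g0 : g 0 = 0 by have := gL (-1) 0 0; rewrite scaler0 addr0 scaleN1r addNr.
apply/asboolP; split; first by move=> a x y /=; rewrite linearP gL.
exists (n * d)%N => i x ni Ax /=; have [di|Ndi] := boolP (d %| i)%N.
  apply: (gn (i %/ d)%N); first by rewrite leq_divRL.
  rewrite -[_ \in _]/(hproj _ x \in hpart A (i %/ d * d)) divnK //.
  by rewrite (hproj_hpart _ Ax); case: ifP => // _; exact: hpart0.
suff -> : veronese_proj d_gt0 x = 0 by [].
by apply/val_inj; rewrite /= (hproj_hpart _ Ax) -/(dvdn d i) (negPf Ndi).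
Qed.

(** Extension by zero embeds omega_V into omega_A, as the forms that vanish on
the degrees not divisible by d. *)
Definition canonical_ext (g : canonical_module V) : canonical_module A :=
  CanonicalModule (canonical_ext_subproof g).

(** Extension is V-linear because rho is. *)
Lemma canonical_ext_linear (a : V) g h :
  canonical_ext (a *: g + h) =
  veronese_incl a *: canonical_ext g + canonical_ext h.
Proof.
apply/val_inj/funext => x.
rewrite -[LHS]/(g (a * veronese_proj d_gt0 x) + h (veronese_proj d_gt0 x)).
rewrite -[RHS]/(g (veronese_proj d_gt0 (veronese_incl a * x)) +
                h (veronese_proj d_gt0 x)).
by rewrite veronese_projM.
Qed.

Section Transfer.
Variables (c : A) (phi : {linear canonical_module A -> A^o}).

(** An arbitrary map from omega_A to A yields a map from omega_V to V because rho
brings its values back into V; c serves to adjust degrees. *)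
Definition transfer (g : canonical_module V) : V^o :=
  veronese_proj d_gt0 (c * phi (canonical_ext g)).

Fact transfer_linear : linear transfer.
Proof.
move=> a g h; rewrite /transfer canonical_ext_linear linearP.
rewrite -[_ *: phi _]/(veronese_incl a * _) mulrDr mulrCA linearD /=.
by rewrite veronese_projM.
Qed.

HB.instance Definition _ :=
  GRing.isLinear.Build V (canonical_module V) V^o *:%R transfer transfer_linear.

End Transfer.

(** The heart of the argument.  A form supported on degrees congruent to r
becomes, once multiplied by b of degree r, the extension of a form on V; so b is
absorbed into the argument of phi and the value is one of [transfer c phi]. *)
Lemma trace_residue (phi : {linear canonical_module A -> A^o}) f r b c :
  b \in hpart A r -> (r < d)%N ->
  submod_trace (canonical_module V) (veronese_proj d_gt0
    (b * c * phi (canonical_hproj (fun i => (i %% d)%N == r) f))).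
Proof.
move=> Ab rd.
have -> : b * c * phi (canonical_hproj (fun i => (i %% d)%N == r) f) =
    c * phi (canonical_ext (canonical_res (b *: f))).
  rewrite mulrAC mulrC; congr (c * _).
  rewrite -[b * _]/(b *: phi _) -linearZ; congr (phi _).
  apply/val_inj/funext => x.
  rewrite -[LHS]/(f (hproj _ (b * x))) -[RHS]/(f (b * hproj _ x)); congr (f _).
  (* The degree r + j is congruent to r exactly when d divides j. *)
  apply: (hprojM _ Ab) => j.
  by have := eqn_modDl r j 0 d; rewrite addn0 mod0n (modn_small rd).
exact: (submod_trace_hom (transfer c phi)).
Qed.

End CanonicalModule.

(** * Near Gorensteinness of the Veronese subalgebra *)

Section Conclusion.
Variables (k : fieldType) (A : gradedAlgebra k) (d : nat) (d_gt0 : (0 < d)%N).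
Local Notation V := (veronese A d_gt0).

(** Induction on degree, from A_((i+1)d) = A_d A_(id). *)
Lemma standard_veronese : standard_graded A -> standard_graded V.
Proof.
move=> stdA; have [noethA A0 _] := stdA; split.
- apply: noetherian_retract noethA; last exact: veronese_projK.
    exact: linearD.
  exact: veronese_projM.
- move=> x; rewrite -[x \in _]/(veronese_incl x \in hpart A 0).
  split=> [/A0[c xE]|[c ->]]; first by exists c; apply/val_inj.
  by apply/A0; exists c.
- move=> S [S1 SL SM] AS x.
  have S0 : 0 \in S by have := SL (-1) 1 1 S1 S1; rewrite scaleN1r addNr.
  have SD u v : u \in S -> v \in S -> u + v \in S.
    by move=> Su Sv; rewrite -[u]scale1r; exact: SL.
  have Sh i y : y \in hpart A (i * d) -> veronese_proj d_gt0 y \in S.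
    elim: i y => [|i IH] y.
      move/A0 => [c ->]; rewrite linearZ /=.
      have -> : veronese_proj d_gt0 (1 : A) = 1.
        by rewrite -[1 : A]/(veronese_incl (1 : V)) veronese_projK.
      by rewrite -[c *: _]addr0; exact: SL.
    apply: (hpartD_ind stdA (C := fun y => veronese_proj d_gt0 y \in S)).
      by rewrite linear0.
      by move=> u v Su Sv; rewrite linearD; exact: SD.
    move=> u v Au Av.
    have Vu : u \in veronese_pred d.
      by apply: (@hpart_veronese _ _ _ 1); rewrite mul1n.
    rewrite -[u]/(veronese_incl (VeroneseSub Vu : V)) veronese_projM; apply: SM.
      by apply: AS; rewrite -[_ \in _]/(u \in hpart A (1 * d)) mul1n.
    exact: IH.
  have [n [f [Af ->]]] := hpart_span V x.
  elim/big_ind: _ => // i _; rewrite -[f i]veronese_projK; apply: (Sh i).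
  exact: Af.
Qed.

(** A_((i+1)d) = A_d A_(id) and A_d = A_1 A_(d-1) reduce the claim to products
l w; the degree r factor of w needed for the residue r part of the argument of
phi exists as r <= d - 1. *)
Lemma trace_veronese : nearly_gorenstein A ->
  forall x : V, irrelevant_ideal x -> submod_trace (canonical_module V) x.
Proof.
move=> [stdA _ trA] _ [n [f [Af ->]]].
elim/big_ind: _ => [|u v|i _].
- exact: submod_trace0.
- exact: submod_traceD.
rewrite -[f i]veronese_projK.
have : veronese_incl (f i) \in hpart A (d + i * d) by exact: (Af i).
move: (veronese_incl _) => x.
pose C y := submod_trace (canonical_module V) (veronese_proj d_gt0 y).
have C0 : C 0 by rewrite /C linear0; exact: submod_trace0.
have CD u v : C u -> C v -> C (u + v).
  by rewrite /C linearD; exact: submod_traceD.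
apply: (hpartD_ind stdA (C := C)) => // y z Ay Az.
have Vz : z \in veronese_pred d by exact: hpart_veronese Az.
rewrite /C mulrC -[z]/(veronese_incl (VeroneseSub Vz : V)) veronese_projM.
apply: submod_traceM; rewrite -/(C y); move: y Ay {z Az Vz}.
rewrite -(prednK d_gt0); apply: (hpartS_ind stdA (C := C)) => // l w Al Aw.
have /trA[m [phi [g ->]]] : irrelevant_ideal l.
  exists 1%N, (fun i => if i == 0%N then l else 0).
  rewrite big_ord1; split=> //.
  by case=> [//|j]; exact: hpart0.
rewrite mulr_suml; elim/big_ind: _ => // j _.
(* The factorisation of w depends on r, hence the splitting comes first. *)
rewrite (canonical_residues (g j) d_gt0) linear_sum mulr_suml.
elim/big_ind: _ => // r _.
have : w \in hpart A (r + (d.-1 - r)).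
  by rewrite subnKC // -ltnS (prednK d_gt0).
apply: (hpartD_ind stdA (C := fun w => C (_ * w))) => [|u v|b c Ab _].
- by rewrite mulr0.
- by rewrite mulrDr; exact: CD.
- by rewrite mulrC; exact: trace_residue.
Qed.

End Conclusion.

Theorem corollary3p3 (k : fieldType) (A : gradedAlgebra k)
    (hA : nearly_gorenstein A) (d : nat) (hd : (0 < d)%N) :
  nearly_gorenstein (veronese A hd).
Proof.
have [stdA artA _] := hA; split; first exact: standard_veronese.
- apply: artinian_retract artA; last exact: veronese_projK.
    exact: linearD.
  exact: veronese_projM.
- exact: trace_veronese.
Qed.
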